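(* Let $N\ge 1$ be an integer and $L>0$. If $\phi\in H^1_{loc}(\mathbb{R}^N)$ is a locally integrable solution of $$\Delta^2\phi+\Delta\phi+\frac12|\nabla\phi|^2=0\quad\text{in }\mathbb{R}^N$$ that is periodic, in the sense that $\phi(x+Le_j)=\phi(x)$ for $j=1,\dots,N$, then $\phi$ is constant. That is, the only periodic solutions of this equation are the constants.
   Context: Here $e_1,\dots,e_N$ is the standard basis of $\mathbb{R}^N$. A real-valued function $\phi\in H^1_{loc}(\mathbb{R}^N)$ is called a locally integrable solution of the equation in $\mathbb{R}^N$ if it satisfies the equation in the sense of distributions, i.e., in $\mathcal{D}'(\mathbb{R}^N)$. Equality of functions is understood almost everywhere. *)

(* Defs.v *)
(* The space R^n is 'rV[R]_n with MathComp-Analysis's norm and topology; its i-th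
   standard basis vector is delta_mx ord0 i. *)
From HB Require Import structures.
From mathcomp Require Import all_boot all_order all_algebra.
From mathcomp Require Import all_classical all_reals all_analysis.

Set Implicit Arguments.
Unset Strict Implicit.
Unset Printing Implicit Defensive.

Import Order.TTheory GRing.Theory Num.Theory.
Import numFieldNormedType.Exports.

Local Open Scope classical_set_scope.
Local Open Scope ring_scope.

Definition rV_display : measure_display.
Proof. exact: default_measure_display. Qed.

(* The sigma-algebra on 'rV[R]_n is generated by the coordinate maps, as the
   library does for n.-tuple; it is the Borel sigma-algebra of R^n. *)
Section rV_measurable.
Context {R : realType} (n : nat).

Let coord (i : 'I_n) (v : 'rV[R]_n) : R := v ord0 i.

Let rV_set0 : g_sigma_preimage coord set0.
Proof. exact: sigma_algebra0. Qed.

Let rV_setC A : g_sigma_preimage coord A -> g_sigma_preimage coord (~` A).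
Proof. exact: sigma_algebraC. Qed.

Let rV_bigcup (F : (set 'rV[R]_n)^nat) :
  (forall i, g_sigma_preimage coord (F i)) ->
  g_sigma_preimage coord (\bigcup_i F i).
Proof. exact: sigma_algebra_bigcup. Qed.

HB.instance Definition _ := @isMeasurable.Build rV_display
  'rV[R]_n (g_sigma_preimage coord) rV_set0 rV_setC rV_bigcup.

End rV_measurable.

Lemma measurable_coord (R : realType) n (i : 'I_n) :
  measurable_fun [set: 'rV[R]_n] (fun v : 'rV[R]_n => v ord0 i).
Proof.
move=> _ Y mY; rewrite setTI; apply: sub_sigma_algebra => /=.
rewrite -bigcup_seq/=; exists i => /=; first by rewrite mem_index_enum.
by exists Y => //; rewrite setTI.
Qed.

Lemma measurable_fun_rVP (R : realType) n d (T : measurableType d)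
    (f : T -> 'rV[R]_n) :
  (forall i, measurable_fun [set: T] (fun x => f x ord0 i)) ->
  measurable_fun [set: T] f.
Proof.
move=> mf; have sub : g_sigma_preimage (fun (i : 'I_n) x => f x ord0 i : R)
    `<=` measurable.
  apply: smallest_sub; first exact: sigma_algebra_measurable.
  rewrite -bigcup_seq; apply: bigcup_sub => i _ A [B mB <-].
  exact: mf.
move=> _ A mA; apply: sub.
rewrite (g_sigma_preimage_comp (fun (i : 'I_n) (v : 'rV[R]_n) => v ord0 i : R) f).
by exists A.
Qed.

Section rV_cons.
Context {R : realType} (n : nat).

Definition rV_cons (p : measurableTypeR R * 'rV[R]_n) : 'rV[R]_n.+1 :=
  \row_i if unlift ord0 i is Some j then p.2 ord0 j else p.1.

Definition rV_uncons (v : 'rV[R]_n.+1) : measurableTypeR R * 'rV[R]_n :=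
  (v ord0 ord0, \row_j v ord0 (lift ord0 j)).

Lemma rV_consK : cancel rV_cons rV_uncons.
Proof.
case=> x v; rewrite /rV_uncons mxE unlift_none; congr pair.
by apply/rowP => j; rewrite !mxE liftK.
Qed.

Lemma measurable_rV_cons : measurable_fun [set: _] rV_cons.
Proof.
apply: measurable_fun_rVP => i.
case: (unliftP ord0 i) => [j|] ->.
  rewrite [X in measurable_fun _ X](_ : _ =
      (fun v : 'rV[R]_n => v ord0 j) \o snd); last first.
    by apply/funext => p /=; rewrite mxE liftK.
  by apply: measurableT_comp; [exact: measurable_coord|exact: measurable_snd].
rewrite [X in measurable_fun _ X](_ : _ = fst); first exact: measurable_fst.
by apply/funext => p /=; rewrite mxE unlift_none.
Qed.

Lemma measurable_rV_uncons : measurable_fun [set: _] rV_uncons.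
Proof.
apply/measurable_fun_pairP; split; first exact: measurable_coord.
apply: measurable_fun_rVP => j.
rewrite [X in measurable_fun _ X](_ : _ =
    (fun v : 'rV[R]_n.+1 => v ord0 (lift ord0 j))); first exact: measurable_coord.
by apply/funext => v /=; rewrite mxE.
Qed.

Variable mu : {sigma_finite_measure set 'rV[R]_n -> \bar R}.

Definition lebesgue_cons : set 'rV[R]_n.+1 -> \bar R :=
  pushforward (lebesgue_measure \x mu)%E rV_cons.

HB.instance Definition _ := Measure.copy lebesgue_cons
  (measure_function_pushforward__canonical__measure_function_Measure
    (lebesgue_measure \x mu)%E measurable_rV_cons).


Let lebesgue_cons_sigma_finite : sigma_finite setT lebesgue_cons.
Proof.
have /sigma_finiteP[F [UF ndF Foo]] := sigma_finiteT (@lebesgue_measure R).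
have /sigma_finiteP[G [UG ndG Goo]] := sigma_finiteT mu.
exists (fun k => rV_uncons @^-1` (F k `*` G k)).
  rewrite -preimage_bigcup -[LHS](preimage_setT rV_uncons); congr (_ @^-1` _).
  apply/esym; rewrite -subTset => -[x v] _.
  have [k _ Fx] : (\bigcup_k F k) x by rewrite -UF.
  have [l _ Gv] : (\bigcup_k G k) v by rewrite -UG.
  exists (maxn k l) => //; split => /=.
    by move: x Fx; exact/subsetPset/ndF/leq_maxl.
  by move: v Gv; exact/subsetPset/ndG/leq_maxr.
move=> k; have [mF Fk] := Foo k; have [mG Gk] := Goo k; split.
  rewrite -[X in measurable X]setTI; apply: measurable_rV_uncons => //.
  exact: measurableX.
rewrite /lebesgue_cons /pushforward -comp_preimage.
rewrite (_ : rV_uncons \o rV_cons = id); last exact/funext/rV_consK.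
by rewrite preimage_id product_measure1E// lte_mul_pinfty// ge0_fin_numE.
Qed.

HB.instance Definition _ := Measure_isSigmaFinite.Build _ _ _
  lebesgue_cons lebesgue_cons_sigma_finite.

End rV_cons.

Fixpoint lebesgue_rV (R : realType) (n : nat) :
    {sigma_finite_measure set 'rV[R]_n -> \bar R} :=
  match n with
  | 0 => [the {sigma_finite_measure set _ -> \bar R} of \d_(0 : 'rV[R]_0)]
  | n'.+1 => [the {sigma_finite_measure set _ -> \bar R} of
               lebesgue_cons (lebesgue_rV R n')]
  end.
Arguments lebesgue_rV : clear implicits.

Lemma lebesgue_rV_box (R : realType) n (A : 'I_n -> set R) :
  (forall i, measurable (A i)) ->
  lebesgue_rV R n [set v | forall i, A i (v ord0 i)] =
  (\prod_(i < n) lebesgue_measure (A i))%E.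
Proof.
elim: n => [|n IHn] in A *; move=> mA.
  rewrite big_ord0 /= diracE mem_set//; by case.
rewrite big_ord_recl /= /lebesgue_cons /pushforward -IHn//.
rewrite -product_measure1E//.
- congr (product_measure1 _ _ _); apply/seteqP; split => -[x v] /=.
    move=> Av; split; first by have := Av ord0; rewrite mxE unlift_none.
    by move=> i; have := Av (lift ord0 i); rewrite mxE liftK.
  by case=> Ax Av i; rewrite mxE; case: unliftP => [j|] ->.
- exact: mA.
- rewrite [X in measurable X](_ : _ = \bigcap_(i in [set: 'I_n])
      ((fun v : 'rV[R]_n => v ord0 i) @^-1` A (lift ord0 i))).
    apply: fin_bigcap_measurable => // i _.
    by rewrite -[X in measurable X]setTI; exact: measurable_coord.
  by apply/seteqP; split => v /= Av i; [move=> _|]; exact: Av.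
Qed.

Section test_functions.
Context {R : realType} {n : nat}.
Implicit Types (f psi : 'rV[R]_n -> R) (i : 'I_n).

Definition partial i f : 'rV[R]_n -> R := fun x => 'D_(delta_mx ord0 i) f x.

Fixpoint Ck (k : nat) f : Prop :=
  match k with
  | 0 => continuous f
  | k'.+1 => continuous f /\
      forall i, (forall x, derivable f x (delta_mx ord0 i)) /\
                Ck k' (partial i f)
  end.

Definition smooth f := forall k, Ck k f.

Definition test_function psi :=
  smooth psi /\ compact (closure [set x | psi x != 0]).

End test_functions.

(* A distribution T is represented by its values T psi, which are only ever
   considered on test functions psi. *)

Section distributions.
Context {R : realType} {n : nat}.
Implicit Types (f : 'rV[R]_n -> R) (T : ('rV[R]_n -> R) -> R).

Definition distr f : ('rV[R]_n -> R) -> R :=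
  fun psi => \int[lebesgue_rV R n]_x (f x * psi x).

Definition dpartial (i : 'I_n) T : ('rV[R]_n -> R) -> R :=
  fun psi => - T (partial i psi).

Definition dlaplacian T : ('rV[R]_n -> R) -> R :=
  fun psi => \sum_(i < n) dpartial i (dpartial i T) psi.

End distributions.

Section H1loc.
Context {R : realType} {n : nat}.
Implicit Types (u f : 'rV[R]_n -> R) (G : 'I_n -> 'rV[R]_n -> R).

(* As in the library, measurability is Borel measurability: a class of functions
   modulo null sets is represented by a Borel function. *)
Definition L2loc f :=
  measurable_fun [set: 'rV[R]_n] f /\
  forall K : set 'rV[R]_n, compact K ->
    (\int[lebesgue_rV R n]_(x in K) ((f x) ^+ 2)%:E < +oo)%E.

(* G is the distributional gradient of u and lies in L^2_loc; such a G is
   unique up to a null set. *)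
Definition L2loc_gradient u G :=
  forall i, L2loc (G i) /\
    forall psi, test_function psi -> dpartial i (distr u) psi = distr (G i) psi.

Definition H1loc u := L2loc u /\ exists G, L2loc_gradient u G.

(* Delta^2 phi + Delta phi + 1/2 |nabla phi|^2 = 0 in D'(R^n), where
   |nabla phi|^2 is the L^1_loc function built from the L^2_loc gradient. *)
Definition distributional_solution (phi : 'rV[R]_n -> R) :=
  exists2 G, L2loc_gradient phi G &
    forall psi, test_function psi ->
      dlaplacian (dlaplacian (distr phi)) psi + dlaplacian (distr phi) psi +
      2^-1 * distr (fun x => \sum_(i < n) G i x ^+ 2) psi = 0.

End H1loc.

(* Main.v *)
Require Import Defs.
From mathcomp Require Import all_boot all_order all_algebra.
From mathcomp Require Import all_classical all_reals all_analysis.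
From mathcomp Require Import measurable_realfun.
From mathcomp Require Import ring lra.
Import Order.TTheory GRing.Theory Num.Theory.
Import numFieldNormedType.Exports.
Local Open Scope classical_set_scope.
Local Open Scope ring_scope.

Set Implicit Arguments.
Unset Strict Implicit.
Unset Printing Implicit Defensive.

(** Integrating the equation over one period kills the two linear terms, which
are divergences, and leaves the mean of |nabla phi|^2; so the gradient vanishes
and phi is constant.  Distributions only accept compactly supported test
functions, so one cannot integrate over a period directly.  Instead the equation
is tested against a function of the form psi(x) = prod_j eta(x_j), where
eta(t) = H(t + A) - H(t - A) for a smooth step H rising from 0 to 1 and A a
multiple of the period L.  Every derivative of eta has the form
q(t + 2A) - q(t) where q, a derivative of H, has compact support.  Hence each
derivative of psi is the difference of a test function and its translate by a
multiple of a period, and it integrates to 0 against phi, because Lebesgue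
measure is translation invariant ([distr_partial_gap]).  The equation is thus
reduced to the vanishing of the integral of |nabla phi|^2 psi; as psi is
nonnegative and equal to 1 on cubes that exhaust the space, the weak gradient is
0 almost everywhere ([gradient_eq0]).

It remains to see that a function with zero weak gradient is constant
([constant_of_gradient_eq0]).  Testing against products of one-variable
functions suffices.  Two one-variable test functions with equal integrals
differ by the derivative of a test function, so each factor f_j may be replaced
by a multiple of a fixed bump.  Therefore the integral of phi times the product
of the f_j is c times the product of the integrals of the f_j, where c does not
depend on the f_j ([distr_tensor_itv_approx]).  Letting f_j tend to the
indicator of ]a_j, b_j], dominated convergence shows that phi - c integrates to
0 over every half-open box.  These boxes form a pi-system generating the Borel
sets, so phi = c almost everywhere ([box_integral_eq0]).

The smooth step is H(t) = e(t) / (e(t) + e(1 - t)) with e(t) = exp(-1/t) for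
t > 0 and e(t) = 0 otherwise. *)

(** * Smooth functions of one variable *)

Section smooth1.
Context {R : realType}.
Implicit Types (f g : R -> R) (k : nat).

(** Counting derivatives makes every closure property below an induction on [k]:
the derivative of a product or an inverse involves the functions themselves, to
which the induction hypothesis applies. *)
Fixpoint derivable_times k f : Prop :=
  if k is k'.+1 then
    (forall x : R, derivable f x 1) /\ derivable_times k' (derive1 f)
  else True.

Definition smooth1 f := forall k, derivable_times k f.

Lemma derivable_timesS k f g : (forall x : R, is_derive x 1 f (g x)) ->
  derivable_times k g -> derivable_times k.+1 f.
Proof.
move=> fg kg; split; first by move=> x; have [] := fg x.
rewrite (_ : (derive1 f) = g)//; apply/funext => x.
by rewrite derive1E; have [_] := fg x.
Qed.

Lemma derivable_times_is_derive k f (x : R) : derivable_times k.+1 f ->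
  is_derive x 1 f (derive1 f x).
Proof. by case=> df _; rewrite derive1E; apply: DeriveDef. Qed.

Lemma derivable_timesW k f : derivable_times k.+1 f -> derivable_times k f.
Proof. by elim: k f => [//|k IH] f [df kf]; split=> //; exact: IH. Qed.

Lemma derivable_times_cst k (c : R) : derivable_times k (cst c).
Proof.
by elim: k c => [//|k IH] c; exact: (@derivable_timesS _ _ (cst 0)).
Qed.

Lemma derivable_timesD k f g : derivable_times k f -> derivable_times k g ->
  derivable_times k (f \+ g).
Proof.
elim: k f g => [//|k IH] f g kf kg.
apply: (@derivable_timesS _ _ (derive1 f \+ derive1 g)); last first.
  by apply: IH; [case: kf|case: kg].
move=> x; have ? := derivable_times_is_derive x kf.
by have ? := derivable_times_is_derive x kg; exact: is_deriveD.
Qed.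

Lemma derivable_timesM k f g : derivable_times k f -> derivable_times k g ->
  derivable_times k (f \* g).
Proof.
elim: k f g => [//|k IH] f g kf kg.
apply: (@derivable_timesS _ _ ((derive1 f \* g) \+ (f \* derive1 g)));
    last first.
  by apply: derivable_timesD; apply: IH; do ?[exact: derivable_timesW];
    [case: kf|case: kg].
move=> x; have df := derivable_times_is_derive x kf.
have dg := derivable_times_is_derive x kg.
by apply: is_derive_eq; rewrite /GRing.scale /=; ring.
Qed.

Lemma derivable_timesV k f : (forall x, f x != 0) -> derivable_times k f ->
  derivable_times k (fun x => (f x)^-1).
Proof.
move=> f0; elim: k => [//|k IH] kf.
apply: (@derivable_timesS _ _ (((derive1 f) \* cst (-1)) \*
    ((fun x => (f x)^-1) \* (fun x => (f x)^-1)))); last first.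
  have fV := IH (derivable_timesW kf).
  apply: derivable_timesM; last exact: derivable_timesM.
  by apply: derivable_timesM; [case: kf|exact: derivable_times_cst].
move=> x; have df := derivable_times_is_derive x kf.
have dV := is_deriveV (f0 x) df.
by apply: is_derive_eq; rewrite /GRing.scale /= -exprVn; ring.
Qed.

Lemma derivable_times_affine k f (a b : R) : derivable_times k f ->
  derivable_times k (fun x => f (a * x + b)).
Proof.
elim: k f => [//|k IH] f kf.
apply: (@derivable_timesS _ _ ((fun x => (derive1 f) (a * x + b)) \* cst a)).
  move=> x; have df := derivable_times_is_derive (a * x + b) kf.
  have daff : is_derive x 1 (fun y : R => a * y + b) a.
    by apply: is_derive_eq; rewrite /GRing.scale /=; ring.
  exact: (@is_derive1_comp _ f (fun y => a * y + b) x _ _ df daff).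
by apply: derivable_timesM; [apply: IH; case: kf|exact: derivable_times_cst].
Qed.

Lemma smooth1_is_derive f (x : R) : smooth1 f ->
  is_derive x 1 f (derive1 f x).
Proof. by move=> /(_ 1%N) kf; exact: derivable_times_is_derive kf. Qed.

Lemma smooth1_derive1 f : smooth1 f -> smooth1 (derive1 f).
Proof. by move=> sf k; case: (sf k.+1). Qed.

Lemma smooth1_continuous f : smooth1 f -> continuous f.
Proof.
move=> sf x; apply/differentiable_continuous/derivable1_diffP.
by case: (smooth1_is_derive x sf).
Qed.

Lemma smooth1M f g : smooth1 f -> smooth1 g -> smooth1 (f \* g).
Proof. by move=> sf sg k; exact: derivable_timesM. Qed.

Lemma smooth1_id : smooth1 (@id R).
Proof.
case=> // k; apply: (@derivable_timesS _ _ (cst 1)).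
exact: derivable_times_cst.
Qed.

End smooth1.

(** * A smooth step *)

Section flat.
Context {R : realType}.
Implicit Types (p q : {poly R}) (t s : R).

(** Each factor [s] of a monomial is absorbed by half of the exponential, since
[s * expR (- (a / 2 * s)) <= 2 / a]; keeping the rate [a] arbitrary is what lets
the induction on [p] go through. *)
Lemma horner_expRN_bounded p (a : R) : 0 < a ->
  exists C : R, forall s, 0 < s -> `|p.[s]| * expR (- (a * s)) <= C.
Proof.
elim/poly_ind: p a => [|p c IH] a a0.
  by exists 0 => s _; rewrite horner0 normr0 mul0r.
have a20 : 0 < a / 2 by lra.
have [C HC] := IH _ a20.
exists (C * (2 / a) + `|c|) => s s0.
rewrite hornerMXaddC (le_trans (ler_wpM2r (expR_ge0 _) (ler_normD _ _)))//.
rewrite mulrDl lerD//; last first.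
  by rewrite ler_piMr// -[leRHS]expR0 ler_expR oppr_le0 mulr_ge0// ltW.
have -> : - (a * s) = - (a / 2 * s) + - (a / 2 * s) by field.
rewrite expRD normrM (gtr0_norm s0).
rewrite [leLHS](_ : _ = (`|p.[s]| * expR (- (a / 2 * s))) *
    (s * expR (- (a / 2 * s)))); last by ring.
apply: ler_pM; [by rewrite mulr_ge0 ?expR_ge0| |exact: HC|].
  by rewrite mulr_ge0 ?expR_ge0 ?ltW.
rewrite expRN ler_pdivrMr ?expR_gt0//.
have -> : 2 / a = (a / 2)^-1 by field; rewrite gt_eqF.
rewrite -ler_pdivrMl ?invr_gt0// invrK.
by apply: le_trans (expR_ge1Dx _); rewrite lerDr.
Qed.

(** The polynomial factor makes this family of flat functions stable under
differentiation, which gives smoothness at [0] by induction. *)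
Definition flat p t : R := if 0 < t then p.[t^-1] * expR (- t^-1) else 0.

Let flat_le p : exists C : R, forall t, `|flat p t| <= C * `|t|.
Proof.
have [C HC] := @horner_expRN_bounded (p * 'X) 1 ltr01.
exists C => t; rewrite /flat; case: ifPn => t0; last first.
  rewrite normr0 mulr_ge0//; apply: le_trans (HC 1 ltr01).
  by rewrite mulr_ge0// expR_ge0.
rewrite (gtr0_norm t0) -ler_pdivrMr// normrM (ger0_norm (expR_ge0 _)).
have ti : 0 < t^-1 by rewrite invr_gt0.
by have := HC _ ti; rewrite hornerMX normrM (gtr0_norm ti) mul1r; lra.
Qed.

Lemma is_derive_flat p t : is_derive t 1 (flat p) (flat ('X^2 * (p - p^`())) t).
Proof.
have [t0|t0|->] := ltgtP t 0.
- apply: (@near_eq_is_derive _ _ _ (cst 0)); last first.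
    by rewrite /flat ltNge (ltW t0); exact: is_derive_cst.
  near=> x; rewrite /flat ltNge ifF//; apply/negbF/ltW.
  by near: x; exact: lt_nbhsl.
- apply: (@near_eq_is_derive _ R^o R^o (fun x : R => p.[x^-1] * expR (- x^-1))).
    near=> x; rewrite /flat ifT//.
    by near: x; exact: lt_nbhsr.
  have tn0 : t != 0 by rewrite gt_eqF.
  have dV : is_derive t 1 (fun x : R => x^-1) (- t ^- 2 *: 1).
    exact: is_deriveV.
  have dp := is_derive1_comp (is_derive_poly p t^-1) dV.
  have dN : is_derive t 1 (fun x : R => - x^-1) (- (- t ^- 2 *: 1)).
    exact: is_deriveN.
  have de := @is_derive1_comp _ expR (fun x => - x^-1) t _ _
    (is_derive_expR (- t^-1)) dN.
  apply: is_derive_eq; rewrite /flat t0 /GRing.scale /=.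
  by rewrite hornerM hornerD hornerN hornerXn -exprVn; ring.
(* The difference quotient of [flat p] at [0] is [flat (p * 'X)], which is
   dominated by a multiple of [`|h|]. *)
- have flat0 q : flat q 0 = 0 by rewrite /flat ltxx.
  have cvg0 : h^-1 *: (flat p (h *: 1 + 0) - flat p 0) @[h --> 0^'] --> (0 : R).
    have [C HC] := flat_le (p * 'X).
    have quotE h : h^-1 *: (flat p (h *: 1 + 0) - flat p 0) = flat (p * 'X) h.
      rewrite flat0 subr0 addr0 /GRing.scale /= mulr1 /flat.
      by case: ifP => _; rewrite ?mulr0// hornerMX; ring.
    apply/cvgr0Pnorm_le => /= e e0.
    near=> h; rewrite quotE (le_trans (HC h))//.
    rewrite (le_trans (ler_wpM2r (normr_ge0 h) (ler_norm C)))//.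
    rewrite (@le_trans _ _ ((`|C| + 1) * `|h|))//.
      by rewrite ler_wpM2r// lerDl.
    rewrite -ler_pdivlMl ?ltr_wpDl// mulrC.
    near: h; apply: dnbhs0_le.
    by rewrite divr_gt0// ltr_wpDl.
  apply: DeriveDef; first by apply/cvg_ex; exists 0.
  by rewrite flat0; exact/cvg_lim.
Unshelve. all: by end_near. Qed.

Lemma smooth1_flat p : smooth1 (flat p).
Proof.
move=> k; elim: k p => // k IH p.
exact: (derivable_timesS (is_derive_flat p)).
Qed.

Lemma flat1_gt0 t : 0 < t -> 0 < flat 1 t.
Proof. by move=> t0; rewrite /flat t0 hornerC mul1r expR_gt0. Qed.

Lemma flat1_ge0 t : 0 <= flat 1 t.
Proof. by rewrite /flat; case: ifP => // _; rewrite hornerC mul1r expR_ge0. Qed.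

Lemma flat_eq0 p t : t <= 0 -> flat p t = 0.
Proof. by rewrite /flat leNgt; case: ifP. Qed.

End flat.

Section step.
Context {R : realType}.
Implicit Types t : R.

Definition step t : R := flat 1 t / (flat 1 t + flat 1 (1 - t)).

Let step_den t : 0 < flat 1 t + flat 1 (1 - t).
Proof.
have [t0|t0] := ltP 0 t; first by rewrite ltr_pwDl ?flat1_gt0 ?flat1_ge0.
by rewrite ltr_wpDl ?flat1_ge0// flat1_gt0//; lra.
Qed.

Lemma smooth1_step : smooth1 step.
Proof.
move=> k; apply: derivable_timesM; first exact: smooth1_flat.
apply: derivable_timesV => [t|]; first by rewrite gt_eqF.
apply: derivable_timesD; first exact: smooth1_flat.
rewrite (_ : (fun t => _) = fun t => flat 1 (-1 * t + 1)).
  by apply: derivable_times_affine; exact: smooth1_flat.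
by apply/funext => t; congr (flat 1 _); ring.
Qed.

Lemma step_eq0 t : t <= 0 -> step t = 0.
Proof. by move=> t0; rewrite /step flat_eq0// mul0r. Qed.

Lemma step_eq1 t : 1 <= t -> step t = 1.
Proof.
move=> t1; rewrite /step [flat 1 (1 - t)]flat_eq0 ?subr_le0// addr0 divff//.
by rewrite gt_eqF// flat1_gt0// (lt_le_trans _ t1).
Qed.

Lemma step_ge0 t : 0 <= step t.
Proof. by rewrite divr_ge0 ?flat1_ge0// ltW. Qed.

Lemma step_le1 t : step t <= 1.
Proof. by rewrite ler_pdivrMr// mul1r lerDl flat1_ge0. Qed.

End step.

(** * Test functions of one variable *)

Section test1.
Context {R : realType}.
Implicit Types (f g q : R -> R) (s t T : R).

Definition supported f := exists M, forall t, M < `|t| -> f t = 0.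

Definition test1 f := smooth1 f /\ supported f.

Lemma derive1_near_cst f (c : R) t : (\forall x \near t, f x = c) ->
  derive1 f t = 0.
Proof.
move=> fc; rewrite derive1E (@near_eq_derive _ _ _ f (cst c))//.
exact: derive_cst.
Qed.

Lemma test1_derive1 f : test1 f -> test1 (derive1 f).
Proof.
move=> [sf [M fM]]; split; first exact: smooth1_derive1.
exists M => t Mt; apply: (derive1_near_cst (c := 0)).
near=> x; apply: fM; near: x.
exact: (@cvgr_gt _ _ _ _ _ _ (@norm_continuous _ R^o t) M Mt).
Unshelve. all: by end_near. Qed.

Lemma test1_bounded f : test1 f -> exists2 C, 0 <= C & forall t, `|f t| <= C.
Proof.
move=> [sf [M fM]].
have cf : {within `[- `|M|, `|M|], continuous (fun t => `|f t|)}.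
  apply: continuous_subspaceT => t; apply: continuous_comp.
    exact: smooth1_continuous.
  exact: (@norm_continuous _ R^o).
have MM : - `|M| <= `|M| by rewrite (@le_trans _ _ 0)// oppr_le0.
have [c _ Hc] := EVT_max MM cf.
exists `|f c| => // t; have [tM|tM] := leP `|t| `|M|.
  by apply: Hc; rewrite in_itv /= -ler_norml.
by rewrite fM ?normr0// (le_lt_trans (ler_norm M)).
Qed.

Lemma smooth1B f g : smooth1 f -> smooth1 g -> smooth1 (f \- g).
Proof.
move=> sf sg k; rewrite (_ : f \- g = f \+ (cst (-1) \* g)).
  apply: derivable_timesD => //; apply: derivable_timesM => //.
  exact: derivable_times_cst.
by apply/funext => t /=; ring.
Qed.

Lemma smooth1Z f (c : R) : smooth1 f -> smooth1 (fun t => c * f t).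
Proof.
move=> sf; apply: (@smooth1M _ (cst c)) => // k.
exact: derivable_times_cst.
Qed.

Lemma smooth1_affine f (c a : R) : smooth1 f ->
  smooth1 (fun t => f (c * (t - a))).
Proof.
move=> sf k; rewrite (_ : (fun t => _) = fun t => f (c * t + - (c * a))).
  exact: derivable_times_affine.
by apply/funext => t; rewrite mulrBr.
Qed.

Lemma derive1_affine f (c a t : R) : smooth1 f ->
  derive1 (fun x => f (c * (x - a))) t = c * derive1 f (c * (t - a)).
Proof.
move=> sf.
have daff : is_derive t 1 (fun y : R => c * (y - a)) c.
  by apply: is_derive_eq; rewrite /GRing.scale /=; ring.
have := @is_derive1_comp _ f (fun y => c * (y - a)) t _ _
   (smooth1_is_derive _ sf) daff.
move=> [_ dfE].
by rewrite derive1E mulrC -dfE.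
Qed.

Lemma derive1B f g t : smooth1 f -> smooth1 g ->
  derive1 (f \- g) t = derive1 f t - derive1 g t.
Proof.
move=> sf sg; have ? := smooth1_is_derive t sf.
have ? := smooth1_is_derive t sg.
by rewrite derive1E derive_val.
Qed.

Lemma derive1Z f (c t : R) : smooth1 f ->
  derive1 (fun t => c * f t) t = c * derive1 f t.
Proof.
move=> sf; have ? := smooth1_is_derive t sf.
by rewrite derive1E derive_val.
Qed.

Lemma test1Z f (c : R) : test1 f -> test1 (fun t => c * f t).
Proof.
move=> [sf [M fM]]; split; first exact: smooth1Z.
by exists M => t Mt; rewrite fM// mulr0.
Qed.

Lemma smooth1_shift f (a : R) : smooth1 f -> smooth1 (fun t => f (t + a)).
Proof.
move=> sf; rewrite (_ : (fun t => _) = fun t => f (1 * (t - - a))).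
  exact: smooth1_affine.
by apply/funext => t; rewrite mul1r opprK.
Qed.

Lemma test1_shift f (a : R) : test1 f -> test1 (fun t => f (t + a)).
Proof.
move=> [sf [M fM]]; split; first exact: smooth1_shift.
exists (M + `|a|) => t Mt; apply: fM; rewrite ltNge; apply/negP => ta.
move: Mt; apply/negP; rewrite -leNgt; have := ler_normB (t + a) a.
by rewrite addrK; lra.
Qed.

Lemma derive1_shift f (a t : R) : smooth1 f ->
  derive1 (fun x => f (x + a)) t = derive1 f (t + a).
Proof.
move=> sf; rewrite -[t + a]mul1r -[a in RHS]opprK -[RHS]mul1r.
rewrite -derive1_affine//; congr (derive1 _ t).
by apply/funext => x; rewrite opprK mul1r.
Qed.

(** Here [q] is typically a step, and only its derivatives have compact support.
The derivatives of [f] are thus differences of a test function and its translate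
by [T], which integrate to [0] against any [T]-periodic function. *)
Definition periodic_gap T f := test1 f /\ exists q, [/\ smooth1 q,
  test1 (derive1 q) & f = fun t => q (t + T) - q t].

Lemma periodic_gap_derive1 T f : periodic_gap T f -> periodic_gap T (derive1 f).
Proof.
move=> [tf [q [sq tq fq]]]; split; first exact: test1_derive1.
exists (derive1 q); split; [exact: smooth1_derive1|exact: test1_derive1|].
apply/funext => t; rewrite {1}fq derive1B//; last exact: smooth1_shift.
by rewrite derive1_shift.
Qed.

Lemma test1_derive1_step : test1 (derive1 (@step R)).
Proof.
split; first exact: smooth1_derive1 smooth1_step.
exists 1 => t; rewrite ltr_normr => /orP[t1|t1].
  apply: (derive1_near_cst (c := 1)); near=> x; apply: step_eq1; apply: ltW.
  by near: x; exact: lt_nbhsr.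
apply: (derive1_near_cst (c := 0)); near=> x; apply: step_eq0; apply: ltW.
by near: x; apply: lt_nbhsl; lra.
Unshelve. all: by end_near. Qed.

Definition plateau A t : R := step (t + A) - step (t - A).

(** With [q t = step (t - A)], as [q (t + (A + A)) = step (t + A)]. *)
Lemma periodic_gap_plateau A : 0 <= A -> periodic_gap (A + A) (plateau A).
Proof.
move=> A0; split.
  split.
    by apply: smooth1B; apply: smooth1_shift; exact: smooth1_step.
  exists (A + 1) => t; rewrite /plateau ltr_normr => /orP[t1|t1].
    by rewrite !step_eq1 ?subrr//; lra.
  by rewrite !step_eq0 ?subrr//; lra.
exists (fun t => step (t - A)); split.
- exact: smooth1_shift smooth1_step.
- rewrite (_ : derive1 _ = fun t => derive1 step (t - A)).
    by apply: test1_shift; exact: test1_derive1_step.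
  by apply/funext => t; rewrite derive1_shift//; exact: smooth1_step.
- by apply/funext => t; rewrite addrA addrK.
Qed.

(** Once [1 <= A + A], at every point one of the two steps is already constant,
and the other lies between [0] and [1]. *)
Lemma plateau_ge0 A t : 1 <= A + A -> 0 <= plateau A t.
Proof.
move=> A1; rewrite /plateau subr_ge0; have [tA|At] := leP t A.
  by rewrite [leLHS]step_eq0 ?step_ge0// subr_le0.
by rewrite [leRHS]step_eq1 ?step_le1//; lra.
Qed.

Lemma plateau_eq1 A t : 1 - A <= t <= A -> plateau A t = 1.
Proof.
move=> /andP[At tA]; rewrite /plateau step_eq1; last lra.
by rewrite step_eq0 ?subr0//; lra.
Qed.

End test1.

(** * Smooth approximations of half-open intervals *)

Section interval.
Context {R : realType}.
Implicit Types (a b t : R).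

(** The derivative of this function is [0] before [0] and [1] after [1], like
[step], and it has an explicit primitive, which replaces integration below. *)
Definition ramp t : R := t * step t.

Lemma smooth1_ramp : smooth1 ramp.
Proof. exact: (smooth1M smooth1_id smooth1_step). Qed.

Lemma derive1_rampE t : derive1 ramp t = step t + t * derive1 step t.
Proof.
have ? := smooth1_is_derive t (@smooth1_step R).
rewrite derive1E /ramp derive_val /GRing.scale /=; ring.
Qed.

Lemma derive1_ramp_bounded :
  exists2 C : R, 0 <= C & forall t, `|derive1 ramp t| <= C.
Proof.
have t1 : test1 (@id R \* derive1 step).
  have [sd [M fM]] := @test1_derive1_step R.
  split; first exact: (smooth1M smooth1_id sd).
  by exists M => t Mt; rewrite /= fM// mulr0.
have [C C0 HC] := test1_bounded t1.
exists (1 + C) => [|t]; first by rewrite addr_ge0.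
rewrite derive1_rampE (le_trans (ler_normD _ _))// lerD//.
  by rewrite ger0_norm ?step_le1 ?step_ge0.
exact: HC.
Qed.

Lemma derive1_ramp_le0 t : t <= 0 -> derive1 ramp t = 0.
Proof.
rewrite le_eqVlt => /predU1P[->|t0].
  by rewrite derive1_rampE mul0r addr0 step_eq0.
apply: (derive1_near_cst (c := 0)); near=> x.
rewrite /ramp step_eq0 ?mulr0//; apply: ltW.
by near: x; exact: lt_nbhsl.
Unshelve. all: by end_near. Qed.

Lemma derive1_ramp_gt1 t : 1 < t -> derive1 ramp t = 1.
Proof.
move=> t1; rewrite derive1_rampE step_eq1 ?(ltW t1)//.
rewrite (derive1_near_cst (c := 1)).
  by rewrite mulr0 addr0.
near=> x; apply: step_eq1; apply: ltW.
by near: x; exact: lt_nbhsr.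
Unshelve. all: by end_near. Qed.

Definition itv_primitive (n : nat) a b t : R :=
  n.+1%:R^-1 * ramp (n.+1%:R * (t - a)) - n.+1%:R^-1 * ramp (n.+1%:R * (t - b)).

Definition itv_approx (n : nat) a b t : R :=
  derive1 ramp (n.+1%:R * (t - a)) - derive1 ramp (n.+1%:R * (t - b)).

Lemma smooth1_itv_primitive n a b : smooth1 (itv_primitive n a b).
Proof.
by apply: smooth1B; apply: smooth1Z; apply: smooth1_affine; exact: smooth1_ramp.
Qed.

Lemma derive1_itv_primitive n a b :
  derive1 (itv_primitive n a b) = itv_approx n a b.
Proof.
apply/funext => t.
have s1 (c : R) : smooth1 (fun t => ramp (n.+1%:R * (t - c))).
  by apply: smooth1_affine; exact: smooth1_ramp.
rewrite derive1B; do ?[by apply: smooth1Z].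
rewrite !derive1Z// !derive1_affine; do ?exact: smooth1_ramp.
by rewrite !mulrA mulVf// !mul1r.
Qed.

Lemma itv_approx_supported n a b t :
  `|a| + `|b| + 1 < `|t| -> itv_approx n a b t = 0.
Proof.
rewrite /itv_approx.
have n1 : 1 <= n.+1%:R :> R by rewrite ler1n.
have := ler_norm a; have := ler_norm b.
have := ler_norm (- a); have := ler_norm (- b).
have := normr_ge0 a; have := normr_ge0 b.
rewrite !normrN ltr_normr => ? ? ? ? ? ? /orP[t1|t1].
  by rewrite !derive1_ramp_gt1 ?subrr//; nra.
by rewrite !derive1_ramp_le0 ?subrr//; nra.
Qed.

Lemma test1_itv_approx n a b : test1 (itv_approx n a b).
Proof.
split.
  rewrite -derive1_itv_primitive; apply: smooth1_derive1.
  exact: smooth1_itv_primitive.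
by exists (`|a| + `|b| + 1); exact: itv_approx_supported.
Qed.

(** The total increase of [itv_primitive n a b] is [b - a] for every [n]: beyond
both ramps, the two affine pieces differ by [n.+1%:R * (b - a)] before the
normalization.  Subtracting [b - a] times the primitive of the reference bump
[itv_approx 0 0 1], whose integral is [1], leaves a function that vanishes on
both sides. *)
Lemma itv_primitive_diff n a b : test1 (fun t =>
  itv_primitive n a b t - (b - a) * itv_primitive 0 0 1 t).
Proof.
split.
  by apply: smooth1B; [|apply: smooth1Z]; exact: smooth1_itv_primitive.
exists (`|a| + `|b| + 2) => t; rewrite /itv_primitive /ramp invr1 !mul1r subr0.
set m : R := n.+1%:R.
have m1 : 1 <= m by rewrite ler1n.
have m0 : m != 0 by rewrite pnatr_eq0.
have := ler_norm a; have := ler_norm b.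
have := ler_norm (- a); have := ler_norm (- b); rewrite !normrN.
have := normr_ge0 a; have := normr_ge0 b.
rewrite ltr_normr => ? ? ? ? ? ? /orP[t1|t1].
  rewrite !step_eq1; [by field|nra..].
rewrite !step_eq0; [by rewrite !(mulr0,subrr)|nra..].
Qed.

Lemma itv_approx_bounded a b : exists2 C : R, 0 <= C &
  forall n t, `|itv_approx n a b t| <= C.
Proof.
have [C C0 HC] := derive1_ramp_bounded.
exists (C + C) => [|n t]; first by rewrite addr_ge0.
by rewrite (le_trans (ler_normB _ _))// lerD.
Qed.

(** The endpoints work out because the derivative of [ramp] vanishes at [0]: the
rescaled steps tend to the indicators of [a < t] and [b < t]. *)
Lemma itv_approx_cvg a b t : a <= b ->
  itv_approx n a b t @[n --> \oo] --> (\1_`]a, b]%classic t : R).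
Proof.
move=> ab.
have ramp_cvg c : derive1 ramp (n.+1%:R * (t - c)) @[n --> \oo] -->
    ((c < t)%R%:R : R).
  have [tc|ct] := leP t c.
    rewrite (_ : (fun n => _) = cst 0); first exact: cvg_cst.
    by apply/funext => n; rewrite derive1_ramp_le0// mulr_ge0_le0// subr_le0.
  apply: cvg_near_cst; near=> n; apply: derive1_ramp_gt1.
  rewrite -ltr_pdivrMr ?subr_gt0//.
  apply: lt_trans (_ : n%:R < _); last by rewrite ltr_nat.
  near: n; exact: nbhs_infty_gtr.
rewrite (_ : \1_`]a, b] t = (a < t)%R%:R - (b < t)%R%:R).
  exact: cvgB.
rewrite indicE mem_setE in_itv /=.
have [ta|at'] := leP t a; first by rewrite /= ltNge (le_trans ta)// subrr.
by case: leP; rewrite ?subr0 ?subrr.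
Unshelve. all: by end_near. Qed.

End interval.

(** * Tensor products as test functions *)

Section tensor.
Context {R : realType} {n : nat}.
Implicit Types (F : 'I_n -> R -> R) (g : R -> R) (i j : 'I_n) (x : 'rV[R]_n).

Definition tensor F x : R := \prod_i F i (x ord0 i).

Definition upd F i g : 'I_n -> R -> R := fun j => if j == i then g else F j.

Lemma tensorE F i x :
  tensor F x = F i (x ord0 i) * \prod_(j | j != i) F j (x ord0 j).
Proof. by rewrite /tensor (bigD1 i). Qed.

Lemma tensor_upd F i g x :
  tensor (upd F i g) x = g (x ord0 i) * \prod_(j | j != i) F j (x ord0 j).
Proof.
rewrite (tensorE _ i) /upd eqxx; congr (_ * _).
by apply: eq_bigr => j ji; rewrite (negbTE ji).
Qed.

Lemma coord_shift (h : R) i j x :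
  (h *: delta_mx ord0 i + x) ord0 j =
  (if j == i then h + x ord0 j else x ord0 j).
Proof.
by rewrite !mxE eqxx /= eq_sym; case: eqP => _; rewrite ?mulr1// mulr0 add0r.
Qed.

Lemma continuous_tensor F :
  (forall i, continuous (F i)) -> continuous (tensor F).
Proof.
move=> cF; apply: continuous_big => [|i _]; first exact: mul_continuous.
by move=> x; apply: continuous_comp; [exact: coord_continuous|exact: cF].
Qed.

(** Along a coordinate axis the other factors are constant, so the difference
quotient is that of one factor times a constant. *)
Lemma is_derive_tensor F i x : smooth1 (F i) ->
  is_derive x (delta_mx ord0 i) (tensor F) (tensor (upd F i (derive1 (F i))) x).
Proof.
move=> sF.
have [dF _] := smooth1_is_derive (x ord0 i) sF.
set c := \prod_(j | j != i) F j (x ord0 j).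
pose quot (h : R) := h^-1 *: (tensor F (h *: delta_mx ord0 i + x) - tensor F x).
have quotE : quot =
    (fun h : R => (h^-1 *: (F i (h *: 1 + x ord0 i) - F i (x ord0 i))) * c).
  apply/funext => h; rewrite /quot !(tensorE F i) coord_shift eqxx.
  rewrite (eq_bigr (fun j => F j (x ord0 j))); last first.
    by move=> j ji; rewrite coord_shift (negbTE ji).
  by rewrite -/c /GRing.scale /= mulr1; ring.
have qcvg : quot h @[h --> 0^'] --> tensor (upd F i (derive1 (F i))) x.
  rewrite tensor_upd -/c quotE derive1E; apply: cvgMl; exact: dF.
apply: DeriveDef; first by apply/cvg_ex; eexists; exact: qcvg.
exact/cvg_lim.
Qed.

Lemma partial_tensor F i : smooth1 (F i) ->
  partial i (tensor F) = tensor (upd F i (derive1 (F i))).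
Proof.
move=> sF; apply/funext => x.
by rewrite /partial; have [_] := is_derive_tensor x sF.
Qed.

Lemma smooth_tensor F : (forall i, smooth1 (F i)) -> smooth (tensor F).
Proof.
move=> sF k; elim: k F sF => [|k IH] F sF.
  by apply: continuous_tensor => i; exact: smooth1_continuous.
split; first by apply: continuous_tensor => i; exact: smooth1_continuous.
move=> i; split=> [x|]; first by have [] := is_derive_tensor x (sF i).
rewrite partial_tensor//; apply: IH => j; rewrite /upd.
by case: ifP => // _; exact: smooth1_derive1.
Qed.

Definition cube (M : R) : set 'rV[R]_n :=
  [set x | forall i, `[- M, M]%classic (x ord0 i)].

Lemma compact_cube M : compact (cube M).
Proof.
exact: (@rV_compact R n (fun=> `[- M, M]%classic)
  (fun=> @segment_compact _ _ _)).
Qed.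

Lemma tensor_supported F : (forall i, supported (F i)) ->
  exists M : R, forall x, ~ cube M x -> tensor F x = 0.
Proof.
move=> /choice[M HM]; exists (\big[Num.max/0]_i M i) => x /existsNP[i].
rewrite /= in_itv /= -ler_norml => /negP; rewrite -ltNge => Mx.
by rewrite (tensorE _ i) HM ?mul0r// (le_lt_trans _ Mx)// le_bigmax.
Qed.

Lemma tensor_test_function F :
  (forall i, test1 (F i)) -> test_function (tensor F).
Proof.
move=> tF; split; first by apply: smooth_tensor => i; case: (tF i).
have [M HM] := @tensor_supported F (fun i => (tF i).2).
apply: (subclosed_compact _ (@compact_cube M)); first exact: closed_closure.
have cM : closed (cube M).
  by apply: compact_closed; [exact: norm_hausdorff|exact: compact_cube].
move/closure_id: cM => ->; apply: closure_subset => x /= /eqP Fx.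
by apply: contrapT => /HM.
Qed.

Lemma tensor_bounded F : (forall i, test1 (F i)) ->
  exists2 C : R, 0 <= C & forall x, `|tensor F x| <= C.
Proof.
move=> tF.
have /choice[C HC] i : exists C : R, 0 <= C /\ forall t, `|F i t| <= C.
  by have [C C0 HC] := test1_bounded (tF i); exists C.
exists (\prod_i C i) => [|x]; first by apply: prodr_ge0 => i _; case: (HC i).
rewrite /tensor normr_prod; apply: ler_prod => i _.
by have [_ Hi] := HC i; rewrite normr_ge0 Hi.
Qed.

Lemma measurable_tensor F : (forall i, measurable_fun setT (F i)) ->
  measurable_fun setT (tensor F).
Proof.
move=> mF; apply: measurable_prod => i _.
by apply: measurableT_comp => //; exact: measurable_coord.
Qed.

Lemma measurable_test1_tensor F : (forall i, test1 (F i)) ->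
  measurable_fun setT (tensor F).
Proof.
move=> tF; apply: measurable_tensor => i.
by apply: continuous_measurable_fun; apply: smooth1_continuous; case: (tF i).
Qed.

End tensor.

(** * Half-open boxes and translation invariance of Lebesgue measure *)

Section boxes.
Context {R : realType} {n : nat}.
Implicit Types (a b : 'I_n -> R) (v x : 'rV[R]_n).

Definition box a b : set 'rV[R]_n :=
  [set x | forall i, `]a i, b i]%classic (x ord0 i)].

Definition boxes : set (set 'rV[R]_n) := [set B | exists a b, B = box a b].

Lemma measurable_pi (A : 'I_n -> set R) : (forall i, measurable (A i)) ->
  measurable [set x : 'rV[R]_n | forall i, A i (x ord0 i)].
Proof.
move=> mA; rewrite [X in measurable X](_ : _ = \bigcap_(i in [set: 'I_n])
    ((fun x : 'rV[R]_n => x ord0 i) @^-1` A i)).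
  apply: fin_bigcap_measurable => // i _.
  by rewrite -[X in measurable X]setTI; exact: measurable_coord.
by apply/seteqP; split => v /= Av i; [move=> _|]; exact: Av.
Qed.

Lemma measurable_box a b : measurable (box a b).
Proof. exact: (measurable_pi (fun=> measurable_itv _)). Qed.

Lemma measurable_cube (M : R) : measurable (@cube R n M).
Proof. exact: (measurable_pi (fun=> measurable_itv _)). Qed.

Definition half_open_cube (k : nat) : set 'rV[R]_n :=
  box (fun=> - k%:R) (fun=> k%:R).

Lemma half_open_cube_cover : \bigcup_k half_open_cube k = setT.
Proof.
apply/seteqP; split => // x _.
pose M : R := 1 + \big[Num.max/0]_i `|x ord0 i|.
exists (Num.truncn M).+1 => // i; rewrite /= in_itv /=.
have xM : `|x ord0 i| < (Num.truncn M).+1%:R.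
  apply: lt_trans (truncnS_gt M); rewrite ltr_pwDl//.
  exact: le_bigmax.
by move: xM; rewrite ltr_norml => /andP[-> /ltW ->].
Qed.

Lemma boxesI : setI_closed boxes.
Proof.
move=> _ _ [a [b ->]] [a' [b' ->]].
exists (fun i => Num.max (a i) (a' i)), (fun i => Num.min (b i) (b' i)).
apply/seteqP; split => x /=.
  move=> [ab ab'] i; have := ab i; have := ab' i.
  by rewrite /= !in_itv /= gt_max le_min => /andP[-> ->] /andP[-> ->].
move=> H; split => i; have := H i; rewrite /= !in_itv /= gt_max le_min.
  by case/andP => /andP[-> _] /andP[->].
by case/andP => /andP[_ ->] /andP[_ ->].
Qed.

(** It is enough that the coordinates be measurable for the sigma-algebra of
boxes, and the preimage of a half-line is a countable union of boxes. *)
Lemma measurable_boxes : measurable = <<s boxes>>.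
Proof.
apply/seteqP; split; last first.
  apply: smallest_sub; first exact: sigma_algebra_measurable.
  by move=> _ [a [b ->]]; exact: measurable_box.
apply: smallest_sub; first exact: smallest_sigma_algebra.
rewrite -bigcup_seq /=; apply: bigcup_sub => i _ _ [B mB <-].
have mcoord : measurable_fun setT
    (fun x : g_sigma_algebraType boxes => (x : 'rV[R]_n) ord0 i : R).
  apply: (measurability (@RGenOInfty.G R)); first exact: RGenOInfty.measurableE.
  move=> _ [_ [y ->] <-]; rewrite setTI.
  rewrite [X in measurable X](_ : _ = \bigcup_k
      box (fun j => if j == i then y else - k%:R) (fun=> k%:R)).
    apply: bigcupT_measurable => k; apply: sub_sigma_algebra.
    by eexists; eexists; reflexivity.
  apply/seteqP; split => x /=.
    rewrite in_itv /= andbT => yx.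
    have [k _ xk] : (\bigcup_k half_open_cube k) x.
      by rewrite half_open_cube_cover.
    exists k => // j; have := xk j; rewrite /= !in_itv /=.
    by case: eqP => [->|//]; rewrite yx => /andP[].
  by move=> [k _ /(_ i)]; rewrite /= eqxx !in_itv /= => /andP[->].
exact: mcoord.
Qed.

Lemma lebesgue_box_lty a b : (lebesgue_rV R n (box a b) < +oo)%E.
Proof.
rewrite (lebesgue_rV_box (fun=> measurable_itv _)).
set p := (\prod_(i < n) _)%E; suff : (0 <= p < +oo)%E by case/andP.
apply: (big_ind (fun x : \bar R => 0 <= x < +oo)%E).
- by rewrite lee01 ltry.
- move=> x y /andP[x0 xoo] /andP[y0 yoo].
  by rewrite mule_ge0// lte_mul_pinfty// ge0_fin_numE.
- move=> i _; rewrite measure_ge0 /= lebesgue_measure_itv /=.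
  by case: ifP => // _; rewrite -EFinB ltry.
Qed.

Lemma lebesgue_box a b : (forall i, a i <= b i) ->
  lebesgue_rV R n (box a b) = (\prod_i (b i - a i))%:E.
Proof.
move=> ab; rewrite (lebesgue_rV_box (fun=> measurable_itv _)) -prodEFin.
apply: eq_bigr => i _; rewrite lebesgue_measure_itv /= lte_fin.
case: ltP => // ba; suff -> : a i = b i by rewrite subrr.
by apply/eqP; rewrite eq_le ab.
Qed.

Lemma measurable_shift v : measurable_fun setT (fun x : 'rV[R]_n => x + v).
Proof.
apply: measurable_fun_rVP => i; under eq_fun do rewrite mxE.
by apply: measurable_funD => //; exact: measurable_coord.
Qed.

Lemma lebesgue_shift v A : measurable A ->
  lebesgue_rV R n ((fun x => x + v) @^-1` A) = lebesgue_rV R n A.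
Proof.
move=> mA; have mv := measurable_shift v.
apply/esym/(measure_unique boxes half_open_cube measurable_boxes boxesI _
  half_open_cube_cover (lebesgue_rV R n)
  (measure_function_pushforward__canonical__measure_function_Measure
    (lebesgue_rV R n) mv)) => //.
- by move=> k; do 2 eexists; reflexivity.
- move=> _ [a [b ->]]; rewrite /= /pushforward.
  rewrite (_ : _ @^-1` _ =
      box (fun i => a i - v ord0 i) (fun i => b i - v ord0 i)).
    rewrite !(lebesgue_rV_box (fun=> measurable_itv _)).
    apply: eq_bigr => i _; rewrite !lebesgue_measure_itv /= !lte_fin ltrD2r.
    by case: ifP => // _; rewrite -!EFinB; congr (_%:E); ring.
  apply/seteqP; split => x xab i; have := xab i;
    by rewrite /= !in_itv /= mxE ltrBlDr lerBrDr.
- by move=> k; exact: lebesgue_box_lty.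
Qed.

End boxes.

(** * Locally integrable functions *)

Section locally_integrable.
Context {R : realType} {n : nat}.
Let mu := lebesgue_rV R n.
Implicit Types (w g : 'rV[R]_n -> R) (v x : 'rV[R]_n).

Definition locally_integrable w := measurable_fun setT w /\
  forall M, mu.-integrable (cube M) (EFin \o w).

Lemma lebesgue_cube_lty (M : R) : (mu (cube M) < +oo)%E.
Proof.
apply: le_lt_trans (lebesgue_box_lty (fun=> - M - 1) (fun=> M)).
apply: le_measure; rewrite ?inE.
- exact: measurable_cube.
- exact: measurable_box.
move=> x xM i; have := xM i; rewrite /= !in_itv /= => /andP[Mx ->].
by rewrite andbT; lra.
Qed.

Lemma locally_integrable_cst (c : R) : locally_integrable (cst c).
Proof.
split=> // M; apply/integrableP; split; first exact/measurable_EFinP.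
rewrite /= integral_cst//; last exact: measurable_cube.
by apply: lte_mul_pinfty; rewrite ?lee_fin//; exact: lebesgue_cube_lty.
Qed.

Lemma locally_integrableB w g : locally_integrable w -> locally_integrable g ->
  locally_integrable (w \- g).
Proof.
move=> [mw iw] [mg ig]; split; first exact: measurable_funB.
by move=> M; exact: (integrableB (@measurable_cube R n M) (iw M) (ig M)).
Qed.

Lemma locally_integrable_sum (I : Type) (r : seq I) (w : I -> 'rV[R]_n -> R) :
  (forall i, locally_integrable (w i)) ->
  locally_integrable (fun x => \sum_(i <- r) w i x).
Proof.
move=> lw; split; first by apply: measurable_sum => i; case: (lw i).
move=> M; rewrite [X in mu.-integrable _ X](_ : _ =
    fun x => (\sum_(i <- r) (w i x)%:E)%E); last first.
  by apply/funext => x; rewrite /= sumEFin.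
by apply: integrable_sum => [|i _]; [exact: measurable_cube|case: (lw i)].
Qed.

Lemma L2loc_sqr w : L2loc w -> locally_integrable (fun x => w x ^+ 2).
Proof.
move=> [mw iw]; split; first exact: measurable_funX.
move=> M; apply/integrableP; split.
  by apply/measurable_EFinP/measurable_funTS; exact: measurable_funX.
under eq_integral do rewrite /= ger0_norm ?sqr_ge0//.
by apply: iw; exact: compact_cube.
Qed.

(** [`|w| <= 1 + w ^+ 2], and constants are integrable on cubes. *)
Lemma L2loc_locally_integrable w : L2loc w -> locally_integrable w.
Proof.
move=> lw; have [mw _] := lw; split=> // M.
have mc : measurable (@cube R n M) by exact: measurable_cube.
apply: (@le_integrable _ _ _ _ _ mc _ (fun x => (1 + w x ^+ 2)%:E)).
- exact/measurable_EFinP/measurable_funTS.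
- move=> x _; rewrite /= lee_fin [leRHS]ger0_norm ?addr_ge0 ?sqr_ge0//.
  by have := sqr_ge0 (`|w x| - 1); rewrite -(real_normK (num_real (w x))); nra.
- apply: (@integrableD _ _ _ mu _ mc (fun=> 1%:E) (fun x => (w x ^+ 2)%:E)).
    by case: (locally_integrable_cst 1).
  by case: (L2loc_sqr lw).
Qed.

Lemma locally_integrableM w g (C M : R) : locally_integrable w ->
  measurable_fun setT g -> (forall x, `|g x| <= C) ->
  (forall x, ~ cube M x -> g x = 0) ->
  mu.-integrable setT (fun x => (w x * g x)%:E).
Proof.
move=> [mw iw] mg gC gM.
have mc : measurable (@cube R n M) by exact: measurable_cube.
rewrite [X in mu.-integrable _ X](_ : _ =
    (fun x => (w x * g x)%:E) \_ (cube M)).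
  apply/(integrable_mkcond _ mc).
  apply: (@le_integrable _ _ _ _ _ mc _ (fun x => C%:E * (w x)%:E)%E).
  - by apply/measurable_EFinP/measurable_funTS; exact: measurable_funM.
  - move=> x _; rewrite /= lee_fin !normrM mulrC ler_wpM2r//.
    exact: le_trans (ler_norm C).
  - by apply: integrableZl.
apply/funext => x; rewrite patchE; case: ifPn => // /negP.
by rewrite inE => /gM ->; rewrite mulr0.
Qed.

Lemma integral_shift v (f : 'rV[R]_n -> \bar R) : measurable_fun setT f ->
  (\int[mu]_x f (x + v)%R = \int[mu]_x f x)%E.
Proof.
move=> mf; have mv := measurable_shift v.
have shiftE (g : 'rV[R]_n -> \bar R) : measurable_fun setT g ->
    (forall x, 0 <= g x)%E ->
    (\int[mu]_x g (x + v)%R = \int[mu]_x g x)%E.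
  move=> mg g0; have := @ge0_integral_pushforward _ _ _ _ _ _ mv mu setT g
    measurableT mg (fun x _ => g0 x).
  rewrite preimage_setT => <-; apply: eq_measure_integral => A mA _.
  exact: lebesgue_shift.
rewrite integralE [RHS]integralE; congr (_ - _)%E.
  rewrite -(shiftE _ (measurable_funepos mf) (funepos_ge0 f)).
  by apply: eq_integral => x _; rewrite !funeposE.
rewrite -(shiftE _ (measurable_funeneg mf) (funeneg_ge0 f)).
by apply: eq_integral => x _; rewrite !funenegE.
Qed.

(** On a fixed half-open cube [w] is integrable and the sets over which its
integral vanishes form a Dynkin system; it contains the boxes, hence all
measurable sets. *)
Lemma box_integral_eq0 w : locally_integrable w ->
  (forall a b, (forall i, a i <= b i) ->
    (\int[mu]_(x in box a b) (w x)%:E = 0)%E) ->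
  \forall x \ae mu, w x = 0.
Proof.
move=> [mw iw] w0.
have box0 a b : (\int[mu]_(x in box a b) (w x)%:E = 0)%E.
  have [/forallP ab|] := boolP [forall i, a i <= b i]; first exact: w0.
  rewrite negb_forall => /existsP[i]; rewrite -ltNge => ba.
  rewrite (_ : box a b = set0) ?integral_set0//.
  apply/seteqP; split => // x /(_ i).
  rewrite /= in_itv /= => /andP[ax xb].
  by have := lt_trans (lt_le_trans ax xb) ba; rewrite ltxx.
have ik k : mu.-integrable (half_open_cube k) (EFin \o w).
  apply: integrableS (iw k%:R); [exact: measurable_cube|exact: measurable_box|].
  move=> x xk i; have := xk i; rewrite /= !in_itv /= => /andP[/ltW -> ->//].
have mk k : measurable (@half_open_cube R n k) by exact: measurable_box.
have mEw D : measurable_fun D (EFin \o w).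
  exact/measurable_EFinP/measurable_funTS.
have all0 k A : measurable A ->
    (\int[mu]_(x in A `&` half_open_cube k) (w x)%:E = 0)%E.
  rewrite measurable_boxes.
  apply: (dynkin_induction (P := fun A =>
     (\int[mu]_(x in A `&` half_open_cube k) (w x)%:E = 0)%E)
     measurable_boxes boxesI).
  - by rewrite setTI box0.
  - move=> _ [a [b ->]].
    have [a' [b' E]] : @boxes R n (box a b `&` half_open_cube k).
      by apply: boxesI; do 2 eexists; reflexivity.
    by rewrite E box0.
  - move=> S mS S0.
    have := box0 (fun=> - k%:R) (fun=> k%:R); rewrite -/(@half_open_cube R n k).
    rewrite -[X in (\int[_]_(x in X) _)%E](setUIDK _ S).
    rewrite integral_setU//; [|exact: measurableI|exact: measurableD|].
      by rewrite setIC S0 add0e setDE setIC.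
    by apply/disj_setPS => x [[_ Sx] [_]].
  - move=> F mF tF F0; rewrite setI_bigcupl integral_bigcup.
    + by apply: eseries0 => i _ _; exact: F0.
    + exact: trivIset_setIr.
    + by move=> i; exact: measurableI.
    + apply: integrableS (ik k) => //.
        by apply: bigcupT_measurable => i; exact: measurableI.
      by apply: bigcup_sub => i _; exact: subIsetr.
have : \forall x \ae mu, forall k, half_open_cube k x -> (w x)%:E = 0%E.
  apply: ae_foralln => k; apply: (integral_ae_eq (mk k) (ik k)) => // E Ek mE.
  by rewrite integral0 -(setIidl Ek) all0.
apply: filterS => x wx.
have [k _ xk] : (\bigcup_k half_open_cube k) x by rewrite half_open_cube_cover.
by have [] := wx k xk.
Qed.

End locally_integrable.

(** * Periodic distributions tested on tensor products *)

Section distributions_on_tensors.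
Context {R : realType} {n : nat}.
Let mu := lebesgue_rV R n.
Implicit Types (w phi psi : 'rV[R]_n -> R) (F : 'I_n -> R -> R) (i j : 'I_n).

Lemma integrable_tensor w F : locally_integrable w -> (forall i, test1 (F i)) ->
  mu.-integrable setT (fun x => (w x * tensor F x)%:E).
Proof.
move=> lw tF; have [C _ HC] := tensor_bounded tF.
have [M HM] := tensor_supported (fun i => (tF i).2).
by apply: locally_integrableM HC HM => //; exact: measurable_test1_tensor.
Qed.

Lemma upd_test1 F i g : (forall j, test1 (F j)) -> test1 g ->
  forall j, test1 (upd F i g j).
Proof. by move=> tF tg j; rewrite /upd; case: ifP. Qed.

Lemma distr_tensorB w F i f g :
  locally_integrable w -> (forall i, test1 (F i)) -> test1 f -> test1 g ->
  distr w (tensor (upd F i (f \- g))) =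
  distr w (tensor (upd F i f)) - distr w (tensor (upd F i g)).
Proof.
move=> lw tF tf tg; rewrite /distr -RintegralB//.
- by apply: eq_Rintegral => x _; rewrite !tensor_upd /=; ring.
- exact: (integrable_tensor lw (upd_test1 i tF tf)).
- exact: (integrable_tensor lw (upd_test1 i tF tg)).
Qed.

Lemma distr_tensorZ w F i g (c : R) :
  locally_integrable w -> (forall i, test1 (F i)) -> test1 g ->
  distr w (tensor (upd F i (fun t => c * g t))) =
  c * distr w (tensor (upd F i g)).
Proof.
move=> lw tF tg; rewrite /distr -RintegralZl//.
  by apply: eq_Rintegral => x _; rewrite !tensor_upd /=; ring.
exact: (integrable_tensor lw (upd_test1 i tF tg)).
Qed.

Lemma distr_shift phi psi (v : 'rV[R]_n) :
  measurable_fun setT phi -> measurable_fun setT psi ->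
  (\forall x \ae mu, phi (x + v) = phi x) ->
  distr phi (fun x => psi (x + v)) = distr phi psi.
Proof.
move=> mphi mpsi per.
have mv (f : 'rV[R]_n -> R) : measurable_fun setT f ->
    measurable_fun setT (fun x : 'rV[R]_n => f (x + v)).
  by move=> mf; exact: (measurableT_comp mf (measurable_shift v)).
rewrite /distr /Rintegral; congr fine.
rewrite -(integral_shift v (f := fun x => (phi x * psi x)%:E)); last first.
  by apply/measurable_EFinP; exact: measurable_funM.
apply: ae_eq_integral => //.
- by apply/measurable_EFinP/measurable_funM => //; exact: mv.
- by apply/measurable_EFinP/measurable_funM => //; exact: mv.
- by apply: filterS per => x -> _.
Qed.

Lemma distr_shiftMn phi psi (v : 'rV[R]_n) k :
  measurable_fun setT phi -> measurable_fun setT psi ->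
  (\forall x \ae mu, phi (x + v) = phi x) ->
  distr phi (fun x => psi (x + v *+ k)) = distr phi psi.
Proof.
move=> mphi mpsi per; elim: k => [|k IH].
  by congr (distr _ _); apply/funext => x; rewrite mulr0n addr0.
rewrite -IH -[RHS](distr_shift _ _ per)//; last first.
  exact: (measurableT_comp mpsi (measurable_shift _)).
by congr (distr _ _); apply/funext => x; rewrite mulrS addrA.
Qed.

(** The [i]-th derivative replaces the [i]-th factor by
[q' (t + L *+ k) - q' t] with [q'] compactly supported: the tensor product is
then a test function translated by [k] periods minus that test function. *)
Lemma distr_partial_gap phi F i (L : R) k : locally_integrable phi ->
  (\forall x \ae mu, phi (x + L *: delta_mx ord0 i) = phi x) ->
  (forall j, periodic_gap (L *+ k) (F j)) ->
  distr phi (partial i (tensor F)) = 0.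
Proof.
move=> lphi per gF.
have tF j : test1 (F j) by case: (gF j).
rewrite partial_tensor; last by case: (tF i).
have [_ [q [sq tq Fq]]] := gF i.
rewrite (_ : derive1 (F i) =
    (fun t => derive1 q (t + L *+ k)) \- derive1 q); last first.
  apply/funext => t; rewrite Fq derive1B//; last exact: smooth1_shift.
  by rewrite derive1_shift.
rewrite distr_tensorB//; last exact: test1_shift.
apply/eqP; rewrite subr_eq0; apply/eqP.
rewrite -[RHS](distr_shiftMn k _ _ per); last 2 first.
- by case: lphi.
- exact: (measurable_test1_tensor (upd_test1 i tF tq)).
congr (distr _ _); apply/funext => x.
rewrite !tensor_upd scalerMnl [x + _]addrC.
rewrite coord_shift eqxx [L *+ k + _]addrC; congr (_ * _).
by apply: eq_bigr => j ji; rewrite coord_shift (negbTE ji).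
Qed.

Lemma dlaplacianE (T : ('rV[R]_n -> R) -> R) psi :
  dlaplacian T psi = \sum_i T (partial i (partial i psi)).
Proof. by apply: eq_bigr => i _; rewrite /dpartial opprK. Qed.

Lemma upd_gap T F i : (forall j, periodic_gap T (F j)) ->
  forall j, periodic_gap T (upd F i (derive1 (F i)) j).
Proof.
move=> gF j; rewrite /upd; case: ifP => // _; exact: periodic_gap_derive1.
Qed.

Lemma dlaplacian_gap phi F (L : R) k : locally_integrable phi ->
  (forall i, \forall x \ae mu, phi (x + L *: delta_mx ord0 i) = phi x) ->
  (forall j, periodic_gap (L *+ k) (F j)) ->
  dlaplacian (distr phi) (tensor F) = 0.
Proof.
move=> lphi per gF; rewrite dlaplacianE big1// => i _.
rewrite (partial_tensor (F := F)); last by have [[]] := gF i.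
by apply: (distr_partial_gap (L := L) (k := k)) => //; exact: upd_gap.
Qed.

Lemma dlaplacian2_gap phi F (L : R) k : locally_integrable phi ->
  (forall i, \forall x \ae mu, phi (x + L *: delta_mx ord0 i) = phi x) ->
  (forall j, periodic_gap (L *+ k) (F j)) ->
  dlaplacian (dlaplacian (distr phi)) (tensor F) = 0.
Proof.
move=> lphi per gF; rewrite dlaplacianE big1// => i _.
have sF j : smooth1 (F j) by have [[]] := gF j.
rewrite !partial_tensor//; last by rewrite /upd eqxx; exact: smooth1_derive1.
by apply: (dlaplacian_gap (L := L) (k := k)) => //; do 2 apply: upd_gap.
Qed.

End distributions_on_tensors.

(** * The weak gradient vanishes *)

Section vanishing_gradient.
Context {R : realType} {n : nat}.
Let mu := lebesgue_rV R n.
Implicit Types (w phi : 'rV[R]_n -> R) (F : 'I_n -> R -> R) (i j : 'I_n).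

Lemma plateau_integral_eq0 w (L : R) : 0 < L -> locally_integrable w ->
  (forall x, 0 <= w x) ->
  (forall k, 1 <= L *+ k + L *+ k ->
    distr w (tensor (fun=> plateau (L *+ k))) = 0) ->
  \forall x \ae mu, w x = 0.
Proof.
move=> L0 lw w0 wk0.
have gap k : forall j : 'I_n, test1 (plateau (L *+ k)).
  move=> _; case: (@periodic_gap_plateau R (L *+ k)) => //.
  by rewrite mulrn_wge0// ltW.
have tens0 k : 1 <= L *+ k + L *+ k ->
    \forall x \ae mu, w x * tensor (fun=> plateau (L *+ k)) x = 0.
  move=> k1; have int := integrable_tensor lw (gap k).
  have psi0 x : 0 <= w x * tensor (fun=> plateau (L *+ k)) x.
    by rewrite mulr_ge0// prodr_ge0// => i _; exact: plateau_ge0.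
  have := ae_eq_integral_abs mu measurableT (measurable_int _ int).
  case=> + _; rewrite (eq_integral
    (fun x => (w x * tensor (fun=> plateau (L *+ k)) x)%:E)); last first.
    by move=> x _; rewrite /= ger0_norm.
  have -> : (\int[mu]_x (w x * tensor (fun=> plateau (L *+ k)) x)%:E = 0)%E.
    have fin := integrable_fin_num measurableT int.
    by rewrite -(fineK fin); congr EFin; exact: wk0.
  move=> /(_ erefl); apply: filterS => x /(_ I) []//.
have : \forall x \ae mu, forall k, 1 <= L *+ k + L *+ k ->
    w x * tensor (fun=> plateau (L *+ k)) x = 0.
  apply: ae_foralln => k; have [k1|k1] := leP 1 (L *+ k + L *+ k).
    by apply: filterS (tens0 k k1).
  exact: aeW.
apply: filterS => x wx.
(* The plateau of half-width [L *+ k] equals 1 at distance 1 from its ends. *)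
pose M : R := 1 + \big[Num.max/0]_i `|x ord0 i|.
pose k := (Num.truncn (M / L)).+1.
have Mk : M < L *+ k.
  rewrite -mulr_natl -ltr_pdivrMr//; exact: truncnS_gt.
have M1 : 1 <= M.
  rewrite lerDl; apply: (big_ind (fun y : R => 0 <= y)) => // y z y0 z0.
  by rewrite le_max y0.
have := wx k; rewrite /tensor big1 ?mulr1 => [|i _]; first by apply; lra.
apply: plateau_eq1; have : `|x ord0 i| <= L *+ k - 1.
  rewrite lerBrDl; apply: le_trans (ltW Mk); rewrite lerD2l.
  exact: le_bigmax.
by rewrite ler_norml => /andP[? ?]; apply/andP; split; lra.
Qed.

Lemma gradient_eq0 phi (G : 'I_n -> 'rV[R]_n -> R) (L : R) : 0 < L ->
  locally_integrable phi -> (forall i, L2loc (G i)) ->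
  (forall i, \forall x \ae mu, phi (x + L *: delta_mx ord0 i) = phi x) ->
  (forall psi, test_function psi ->
      dlaplacian (dlaplacian (distr phi)) psi + dlaplacian (distr phi) psi +
      2^-1 * distr (fun x => \sum_(i < n) G i x ^+ 2) psi = 0) ->
  forall i, \forall x \ae mu, G i x = 0.
Proof.
move=> L0 lphi lG per sol i.
have : \forall x \ae mu, \sum_(i < n) G i x ^+ 2 = 0.
  apply: (plateau_integral_eq0 L0).
  - by apply: locally_integrable_sum => j; exact: L2loc_sqr.
  - by move=> x; apply: sumr_ge0 => j _; exact: sqr_ge0.
  move=> k _.
  have gap (j : 'I_n) : periodic_gap (L *+ (k + k)) (plateau (L *+ k)).
    by rewrite mulrnDr; apply: periodic_gap_plateau; rewrite mulrn_wge0// ltW.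
  have tst : test_function (tensor (fun=> plateau (L *+ k)) : 'rV[R]_n -> R).
    by apply: tensor_test_function => j; case: (gap j).
  have := sol _ tst.
  rewrite (dlaplacian2_gap lphi per gap) (dlaplacian_gap lphi per gap) !add0r.
  by move/eqP; rewrite mulf_eq0 invr_eq0 pnatr_eq0 /= => /eqP.
apply: filterS => x /eqP; rewrite psumr_eq0 => [|j _]; last exact: sqr_ge0.
by move=> /allP/(_ i); rewrite mem_index_enum sqrf_eq0 => /(_ isT)/eqP.
Qed.

End vanishing_gradient.

(** * A function with zero weak gradient is constant *)

Section constancy.
Context {R : realType} {n : nat}.
Let mu := lebesgue_rV R n.
Implicit Types (w phi : 'rV[R]_n -> R) (F : 'I_n -> R -> R) (i j : 'I_n).

(** The difference of [f] and [c * g] is the derivative of a test function, and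
a zero weak gradient does not see it. *)
Lemma distr_tensor_swap phi F i f g p (c : R) : locally_integrable phi ->
  (forall i F, (forall j, test1 (F j)) ->
    distr phi (partial i (tensor F)) = 0) ->
  (forall j, test1 (F j)) -> test1 f -> test1 g -> test1 p ->
  derive1 p = (f \- (fun t => c * g t)) ->
  distr phi (tensor (upd F i f)) = c * distr phi (tensor (upd F i g)).
Proof.
move=> lphi grad0 tF tf tg tp pE; rewrite -distr_tensorZ//.
apply/eqP; rewrite -subr_eq0 -distr_tensorB//; last exact: test1Z.
rewrite -pE; apply/eqP.
rewrite -(grad0 i (upd F i p)); last exact: upd_test1.
rewrite partial_tensor; last by rewrite /upd eqxx; case: tp.
congr (distr _ (tensor _)); apply/funext => j; rewrite /upd eqxx.
by case: ifP.
Qed.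

Lemma distr_tensor_itv_approx phi : locally_integrable phi ->
  (forall i F, (forall j, test1 (F j)) ->
    distr phi (partial i (tensor F)) = 0) ->
  exists c : R, forall k (a b : 'I_n -> R),
    distr phi (tensor (fun i => itv_approx k (a i) (b i))) =
    c * \prod_i (b i - a i).
Proof.
move=> lphi grad0; pose theta : R -> R := itv_approx 0 0 1.
exists (distr phi (tensor (fun=> theta))) => k a b.
have ttheta : test1 theta by exact: test1_itv_approx.
(* The factors are exchanged for [theta] one coordinate at a time. *)
pose F (r : seq 'I_n) i := if i \in r then itv_approx k (a i) (b i) else theta.
have tF r j : test1 (F r j).
  by rewrite /F; case: ifP => _; [exact: test1_itv_approx|exact: ttheta].
have FE r : uniq r -> distr phi (tensor (F r)) =
    distr phi (tensor (fun=> theta)) * \prod_(i <- r) (b i - a i).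
  elim: r => [_|i r IH /= /andP[ir ur]]; first by rewrite big_nil mulr1.
  rewrite big_cons mulrCA -(IH ur).
  have -> : F (i :: r) = upd (F r) i (itv_approx k (a i) (b i)).
    by apply/funext => j; rewrite /upd /F in_cons; case: eqP => [->|].
  have gE : derive1 (fun t => itv_primitive k (a i) (b i) t -
        (b i - a i) * itv_primitive 0 0 1 t) =
      itv_approx k (a i) (b i) \- (fun t => (b i - a i) * theta t).
    have sg m (x y : R) := @smooth1_itv_primitive R m x y.
    apply/funext => t; rewrite derive1B; [|exact: sg|exact: smooth1Z].
    by rewrite derive1Z; [rewrite !derive1_itv_primitive|exact: sg].
  rewrite (distr_tensor_swap i lphi grad0 (tF r) (test1_itv_approx k _ _) ttheta
    (itv_primitive_diff k (a i) (b i)) gE).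
  congr (_ * distr _ (tensor _)); apply/funext => j.
  by rewrite /upd /F; case: eqP => // ->; rewrite (negbTE ir).
rewrite -FE ?index_enum_uniq//; congr (distr _ (tensor _)); apply/funext => i.
by rewrite /F mem_index_enum.
Qed.

Lemma box_integral_cvg phi (a b : 'I_n -> R) : locally_integrable phi ->
  (forall i, a i <= b i) ->
  distr phi (tensor (fun i => itv_approx k (a i) (b i))) @[k --> \oo] -->
  \int[mu]_(x in box a b) phi x.
Proof.
move=> lphi ab.
pose f k x := (phi x * tensor (fun i => itv_approx k (a i) (b i)) x)%:E.
have tk k i : test1 (itv_approx k (a i) (b i)) by exact: test1_itv_approx.
have intk k : mu.-integrable setT (f k).
  exact: (integrable_tensor lphi (tk k)).
pose M : R := \big[Num.max/0]_i (`|a i| + `|b i| + 1).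
have HM k x : ~ cube M x -> tensor (fun i => itv_approx k (a i) (b i)) x = 0.
  move=> /existsNP[i]; rewrite /= in_itv /= -ler_norml => /negP.
  rewrite -ltNge => Mx; rewrite (tensorE _ i).
  rewrite itv_approx_supported ?mul0r// (le_lt_trans _ Mx)//.
  exact: (le_bigmax _ (fun i => `|a i| + `|b i| + 1)).
have /choice[C HC] i : exists C : R,
    0 <= C /\ forall k t, `|itv_approx k (a i) (b i) t| <= C.
  by have [C C0 HC] := itv_approx_bounded (a i) (b i); exists C.
pose D : R := \prod_i C i.
have HD k x : `|tensor (fun i => itv_approx k (a i) (b i)) x| <= D.
  rewrite /tensor normr_prod; apply: ler_prod => i _.
  by have [_ Hi] := HC i; rewrite normr_ge0 Hi.
have mc : measurable (@cube R n M) by exact: measurable_cube.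
have indE (x : 'rV[R]_n) :
    \prod_i \1_`]a i, b i]%classic (x ord0 i) = \1_(box a b) x :> R.
  rewrite [RHS]indicE.
  case: (boolP (x \in box a b)) => [|/negP]; rewrite inE => xab.
    by rewrite big1// => i _; rewrite indicE mem_set//; exact: xab.
  have /existsNP[i xi] : ~ forall i, `]a i, b i]%classic (x ord0 i) by [].
  by rewrite (bigD1 i)//= indicE memNset// mul0r.
have fcvg x : f k x @[k --> \oo] --> ((EFin \o phi) \_ (box a b)) x.
  have -> : ((EFin \o phi) \_ (box a b)) x = (phi x * \1_(box a b) x)%:E.
    by rewrite patchE indicE; case: ifP; rewrite ?mulr1 ?mulr0.
  apply: cvg_EFin; first by near=> k.
  apply: cvgMr; rewrite -indE.
  apply: cvg_big => [|i _]; first exact: mul_continuous.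
  exact: itv_approx_cvg.
have [mphi iphi] := lphi.
have mlim : measurable_fun setT ((EFin \o phi) \_ (box a b)).
  apply/(measurable_restrictT _ (measurable_box a b)).
  exact/measurable_EFinP/measurable_funTS.
have idom : mu.-integrable setT ((fun x => D%:E * (`|phi x|)%:E)%E \_ (cube M)).
  apply/(integrable_mkcond _ mc); apply: integrableZl => //.
  exact: (integrable_norm (iphi M)).
have dom : \forall x \ae mu, forall k, [set: 'rV[R]_n] x ->
    (`|f k x| <= ((fun x => D%:E * (`|phi x|)%:E)%E \_ (cube M)) x)%E.
  apply: aeW => x k _; rewrite patchE /f; case: ifPn => [_|/negP].
    by rewrite /= lee_fin normrM mulrC ler_wpM2r.
  by rewrite inE => /HM ->; rewrite mulr0 abse0.
have [ilim _] := dominated_convergence measurableT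
  (fun k => measurable_int _ (intk k)) mlim (aeW _ (fun x _ => fcvg x))
  idom dom.
rewrite -integral_mkcond => icvg.
apply: fine_cvg; rewrite fineK//.
apply: integrable_fin_num; first exact: measurable_box.
exact/(integrable_mkcond _ (measurable_box a b)).
Unshelve. all: by end_near. Qed.

Lemma constant_of_gradient_eq0 phi : locally_integrable phi ->
  (forall i F, (forall j, test1 (F j)) ->
    distr phi (partial i (tensor F)) = 0) ->
  exists c : R, \forall x \ae mu, phi x = c.
Proof.
move=> lphi grad0; have [c Hc] := distr_tensor_itv_approx lphi grad0.
exists c; have lc := @locally_integrable_cst R n c.
have : \forall x \ae mu, (phi \- cst c) x = 0.
  apply: box_integral_eq0; first exact: locally_integrableB.
  move=> a b ab; have mb := measurable_box a b.
  have ib w : locally_integrable w -> mu.-integrable (box a b) (EFin \o w).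
    move=> [mw iw].
    apply: integrableS (iw (\big[Num.max/0]_i (Num.max `|a i| `|b i|))).
    - exact: measurable_cube.
    - exact: mb.
    - move=> x xab i; have := xab i; rewrite /= !in_itv /= => /andP[ax xb].
      have := le_bigmax 0 (fun i => Num.max `|a i| `|b i|) i.
      set m := \big[_/_]_(_ | _) _; rewrite ge_max !ler_norml.
      move=> /andP[/andP[am _] /andP[_ bm]].
      by rewrite (ltW (le_lt_trans am ax)) (le_trans xb).
  have -> : (\int[mu]_(x in box a b) ((phi \- cst c) x)%:E =
     \int[mu]_(x in box a b) (phi x)%:E - \int[mu]_(x in box a b) c%:E)%E.
    rewrite -(integralB_EFin mb (ib _ lphi) (ib _ lc)).
    by apply: eq_integral.
  rewrite integral_cst//.
  rewrite [X in (_ * X)%E](_ : _ = (\prod_i (b i - a i))%:E); last first.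
    exact: lebesgue_box.
  have fin := integrable_fin_num mb (ib _ lphi).
  rewrite -(fineK fin).
  have -> : fine (\int[mu]_(x in box a b) (EFin \o phi) x)%E =
      c * \prod_i (b i - a i).
    apply/esym; apply: cvg_unique (box_integral_cvg lphi ab).
      exact: norm_hausdorff.
    rewrite (_ : (fun k => _) = cst (c * \prod_i (b i - a i))).
      exact: cvg_cst.
    exact/funext.
  by rewrite -EFinM -EFinB subrr.
by apply: filterS => x /= /eqP; rewrite subr_eq0 => /eqP.
Qed.

End constancy.

(** * Periodic solutions *)

Theorem corollary3 (R : realType) (N : nat) (L : R) (phi : 'rV[R]_N -> R)
  (N_ge1 : (1 <= N)%N) (L_gt0 : 0 < L)
  (phi_H1loc : H1loc phi)
  (phi_solution : distributional_solution phi)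
  (phi_periodic : forall j : 'I_N,
    \forall x \ae lebesgue_rV R N, phi (x + L *: delta_mx ord0 j) = phi x) :
  exists c : R, \forall x \ae lebesgue_rV R N, phi x = c.
Proof.
have lphi : locally_integrable phi.
  by apply: L2loc_locally_integrable; case: phi_H1loc.
have [G gradG sol] := phi_solution.
have L2G i : L2loc (G i) by case: (gradG i).
have G0 := gradient_eq0 L_gt0 lphi L2G phi_periodic sol.
apply: constant_of_gradient_eq0 => // i F tF.
have [_ /(_ _ (tensor_test_function tF))] := gradG i.
rewrite /dpartial => /eqP; rewrite eqr_oppLR => /eqP ->.
apply/eqP; rewrite oppr_eq0; apply/eqP; rewrite /distr /Rintegral.
rewrite (ae_eq_integral (cst 0%E)) ?integral0//.
- apply/measurable_EFinP/measurable_funM; first by case: (L2G i).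
  exact: measurable_test1_tensor.
- by apply: filterS (G0 i) => x -> _; rewrite mul0r.
Qed.
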